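(* Let $s\ge1$, $a_j,b_j\in\mathbb R$ for $j=1,\dots,s$ with $\sum_{j=1}^s a_j=1$, and consider the generalized modified splitting method $$u_{n+1}=e^{b_s hB_s}e^{a_s hA}\,e^{b_{s-1}hB_{s-1}}e^{a_{s-1}hA}\cdots e^{b_1hB_1}e^{a_1hA}\,u_n .$$ Then it can be expanded as a decorated multi-index series: $$u_{n+1}=e^{hA}\,B_\Lambda(\alpha)\,u_n,\qquad \alpha(\mu,\lambda)=\prod_{i=1}^k b_{\lambda_i}\,c_{\lambda_i}^{\mu_i}\quad\text{for }\mu\in\mathbb N^k,\ \lambda\in\Lambda_k,$$ where $c_m=\sum_{j=1}^{m}a_j$.
   Context: $\mathbb N$ contains $0$. $A,B$ are linear operators; operator exponentials and infinite sums are read as formal power series in the time step $h$ (e.g. $A,B$ are elements of a unital associative real algebra $\mathcal A$ and identities hold in $\mathcal A[[h]]$). Commutator: $[X,Y]=XY-YX$; $\mathrm{ad}_X^0(Y)=Y$, $\mathrm{ad}_X^j(Y)=[X,\mathrm{ad}_X^{j-1}(Y)]$. Each operator $B_j$ has the form $B_j=B+c_1^{(j)}h[A,B]+c_2^{(j)}h^2[A,[A,B]]+c_3^{(j)}h^2[B,[A,B]]+c^{(j)}_4h^3[A,[A,[A,B]]]+\cdots$, i.e. $B$ plus a (formal) real linear combination of nested commutators of $A$ and $B$, a nested commutator with $m$ letters being multiplied by $h^{m-1}$. Multi-indices: $\mu=(\mu_1,\dots,\mu_k)\in\mathbb N^k$, $k\ge0$ (empty one: $\mathbf 1$), $\mu!=\prod_j\mu_j!$,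 $|\mu|=k+\sum_j\mu_j$. $\Lambda_k=\{\lambda\in\mathbb N^k: 1\le\lambda_1\le\cdots\le\lambda_k\le s\}$. A decorated multi-index is a pair $(\mu,\lambda)$ with $\mu\in\mathbb N^k$, $\lambda\in\Lambda_k$ for some $k$; their set is $\mathbb N^\infty_\Lambda$. $\mathbb F(\mu,\lambda)=h^{|\mu|}\mathrm{ad}_{-A}^{\mu_k}(B_{\lambda_k})\cdots\mathrm{ad}_{-A}^{\mu_1}(B_{\lambda_1})$, with $\mathbb F(\mathbf 1,\mathbf 1)=\mathrm{id}$. The symmetric sum $\sum^!$ weights each term with decoration $\lambda$ by $\frac1{q_1!\cdots q_s!}$, where $q_i$ is the number of occurrences of $i$ in $\lambda$. The decorated multi-index series is $B_\Lambda(\alpha)=\sum^!_{(\mu,\lambda)\in\mathbb N^\infty_\Lambda}\frac{\alpha(\mu,\lambda)}{\mu!}\mathbb F(\mu,\lambda)$. (Convention $0^0=1$.) *)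

(* Defs.v *)
From HB Require Import structures.
From mathcomp Require Import all_boot all_order all_algebra.
From mathcomp Require Import boolp classical_sets functions cardinality fsbigop reals.

Set Implicit Arguments.
Unset Strict Implicit.
Unset Printing Implicit Defensive.

Import GRing.Theory.
Local Open Scope classical_set_scope.
Local Open Scope ring_scope.

Record fps (T : Type) := Fps { coefs :> nat -> T }.

Section FpsRing.
Variable T : nzRingType.
Implicit Types f g k : fps T.

Lemma fpsP f g : (forall n, f n = g n) <-> f = g.
Proof.
split=> [fg|-> //]; case: f g fg => [f] [g] /= fg.
by congr Fps; apply/funext.
Qed.

HB.instance Definition _ := gen_eqMixin (fps T).
HB.instance Definition _ := gen_choiceMixin (fps T).

Definition fps_zero : fps T := Fps (fun=> 0).
Definition fps_opp f : fps T := Fps (fun n => - f n).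
Definition fps_add f g : fps T := Fps (fun n => f n + g n).

Lemma fps_addA : associative fps_add.
Proof. by move=> f g k; apply/fpsP => n /=; rewrite addrA. Qed.
Lemma fps_addC : commutative fps_add.
Proof. by move=> f g; apply/fpsP => n /=; rewrite addrC. Qed.
Lemma fps_add0 : left_id fps_zero fps_add.
Proof. by move=> f; apply/fpsP => n /=; rewrite add0r. Qed.
Lemma fps_addN : left_inverse fps_zero fps_opp fps_add.
Proof. by move=> f; apply/fpsP => n /=; rewrite addNr. Qed.

HB.instance Definition _ :=
  GRing.isZmodule.Build (fps T) fps_addA fps_addC fps_add0 fps_addN.

Definition fpsC (x : T) : fps T := Fps (fun n => if n is 0%N then x else 0).

Definition fps_mul f g : fps T :=
  Fps (fun n => \sum_(i < n.+1) f i * g (n - i)%N).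

Lemma fps_mul_poly N f g n : (n <= N)%N ->
  fps_mul f g n = (\poly_(i < N.+1) f i * \poly_(i < N.+1) g i)`_n.
Proof.
move=> nN; rewrite coefM; apply: eq_bigr => i _; rewrite !coef_poly !ltnS.
by rewrite (leq_trans _ nN) ?(leq_trans (leq_subr _ _) nN) // -ltnS.
Qed.

Lemma fps_mulA : associative fps_mul.
Proof.
move=> f g k; apply/fpsP => n.
pose P f := \poly_(i < n.+1) coefs f i : {poly T}.
have PE f' m : (m <= n)%N -> (P f')`_m = f' m.
  by move=> mn; rewrite coef_poly ltnS mn.
transitivity ((P f * (P g * P k))`_n).
  rewrite coefM; apply: eq_bigr => i _; congr (_ * _).
    by rewrite PE // -ltnS.
  by apply: fps_mul_poly; apply: leq_subr.
rewrite mulrA coefM; apply: eq_bigr => i _; congr (_ * _).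
  by apply/esym/fps_mul_poly; rewrite -ltnS.
by apply: PE; apply: leq_subr.
Qed.

Lemma fps_mul1 : left_id (fpsC 1) fps_mul.
Proof.
move=> f; apply/fpsP => n /=; rewrite big_ord_recl /= mul1r subn0.
by rewrite big1 ?addr0// => i _; rewrite mul0r.
Qed.

Lemma fps_mulr1 : right_id (fpsC 1) fps_mul.
Proof.
move=> f; apply/fpsP => n /=; rewrite big_ord_recr /= subnn mulr1.
rewrite big1 ?add0r// => i _.
by have := ltn_ord i; rewrite -subn_gt0; case: (n - i)%N => // ? _; rewrite mulr0.
Qed.

Lemma fps_mulDl : left_distributive fps_mul +%R.
Proof.
move=> f g k; apply/fpsP => n /=; rewrite -big_split /=.
by apply: eq_bigr => i _; rewrite mulrDl.
Qed.

Lemma fps_mulDr : right_distributive fps_mul +%R.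
Proof.
move=> f g k; apply/fpsP => n /=; rewrite -big_split /=.
by apply: eq_bigr => i _; rewrite mulrDr.
Qed.

Lemma fps_1neq0 : fpsC 1 != 0.
Proof. by apply/eqP => /fpsP/(_ 0%N)/eqP; rewrite oner_eq0. Qed.

HB.instance Definition _ := GRing.Zmodule_isNzRing.Build (fps T)
  fps_mulA fps_mul1 fps_mulr1 fps_mulDl fps_mulDr fps_1neq0.

Definition fpsh : fps T := Fps (fun n => (n == 1%N)%:R).

(** Infinite sums.  [fps_sum D F] is the h-adic sum of the family [F] over [D];
    it is only meaningful when [fps_summable D F] holds, since a finitely
    supported sum [\sum_(i \in D) _] with infinite support is [0] by
    convention. *)
Definition fps_summable (I : choiceType) (D : set I) (F : I -> fps T) : Prop :=
  forall n, finite_set [set i | D i /\ F i n <> 0].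

Definition fps_sum (I : choiceType) (D : set I) (F : I -> fps T) : fps T :=
  Fps (fun n => \sum_(i \in D) F i n).

End FpsRing.

Arguments fpsh {T}.

Section FpsAlgebra.
Variables (R : pzRingType) (T : algType R).
Implicit Types f g : fps T.

Definition fps_scale (a : R) f : fps T := Fps (fun n => a *: f n).

Lemma fps_scaleA a b f : fps_scale a (fps_scale b f) = fps_scale (a * b) f.
Proof. by apply/fpsP => n /=; rewrite scalerA. Qed.
Lemma fps_scale1 : left_id 1 fps_scale.
Proof. by move=> f; apply/fpsP => n /=; rewrite scale1r. Qed.
Lemma fps_scaleDr : right_distributive fps_scale +%R.
Proof. by move=> a f g; apply/fpsP => n /=; rewrite scalerDr. Qed.
Lemma fps_scaleDl f : {morph fps_scale^~ f : a b / a + b}.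
Proof. by move=> a b; apply/fpsP => n /=; rewrite scalerDl. Qed.

HB.instance Definition _ := GRing.Zmodule_isLmodule.Build R (fps T)
  fps_scaleA fps_scale1 fps_scaleDr fps_scaleDl.

Lemma fps_scaleAl (a : R) f g : a *: (f * g) = (a *: f) * g.
Proof.
apply/fpsP => n /=; rewrite scaler_sumr.
by apply: eq_bigr => i _; rewrite scalerAl.
Qed.

HB.instance Definition _ := GRing.Lmodule_isLalgebra.Build R (fps T) fps_scaleAl.

Lemma fps_scaleAr (a : R) f g : a *: (f * g) = f * (a *: g).
Proof.
apply/fpsP => n /=; rewrite scaler_sumr.
by apply: eq_bigr => i _; rewrite scalerAr.
Qed.

HB.instance Definition _ := GRing.Lalgebra_isAlgebra.Build R (fps T) fps_scaleAr.

End FpsAlgebra.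

Definition fps_exp_term (R : realType) (T : algType R) (X : fps T) (k : nat) :
  fps T := (k`!%:R : R)^-1 *: X ^+ k.

(** Meaningful for [X] without constant term, see [fps_exp_summable]. *)
Definition fps_exp (R : realType) (T : algType R) (X : fps T) : fps T :=
  fps_sum [set: nat] (fps_exp_term X).

Lemma fps_expr_lt (T : nzRingType) (X : fps T) k n :
  X 0%N = 0 -> (n < k)%N -> (X ^+ k) n = 0.
Proof.
move=> X0; elim: k n => [//|k IHk] n nk; rewrite exprS.
apply: big1 => -[[|i] /= ilt] _; first by rewrite X0 mul0r.
rewrite IHk ?mulr0//; apply: leq_ltn_trans (leq_sub2l n (ltn0Sn i)) _.
by case: n nk ilt => [//|n] nk _; rewrite subn1.
Qed.

Lemma fps_exp_summable (R : realType) (T : algType R) (X : fps T) :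
  X 0%N = 0 -> fps_summable [set: nat] (fps_exp_term X).
Proof.
move=> X0 n; apply: (@sub_finite_set _ _ `I_n.+1); last exact: finite_II.
move=> k [_ /= Xk]; rewrite ltnS leqNgt; apply/negP => nk.
by apply: Xk; rewrite fps_expr_lt ?scaler0.
Qed.

Definition commutator (T : nzRingType) (X Y : T) : T := X * Y - Y * X.

Definition ad (T : nzRingType) (X : T) (j : nat) (Y : T) : T :=
  iter j (commutator X) Y.

(** [nested_commutator A B m X]: [X] is a nested commutator with [m] letters,
    each equal to [A] or [B] (any bracketing). *)
Inductive nested_commutator (T : nzRingType) (A B : T) : nat -> T -> Prop :=
| nested_A : nested_commutator A B 1 A
| nested_B : nested_commutator A B 1 B
| nested_bracket m n X Y :
    nested_commutator A B m X -> nested_commutator A B n Y ->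
    nested_commutator A B (m + n)%N (commutator X Y).

(** [X = B + c1 h [A,B] + c2 h^2 [A,[A,B]] + c3 h^2 [B,[A,B]] + ...]. *)
Definition modified_operator (R : realType) (T : algType R) (A B : T)
    (X : fps T) : Prop :=
  X 0%N = B /\
  forall n, (0 < n)%N -> exists r : seq (R * T),
    (forall p, p \in r -> nested_commutator A B n.+1 p.2) /\
    X n = \sum_(p <- r) p.1 *: p.2.

Section Decorated.
Variables (R : realType) (T : algType R) (s : nat).
(* The stages 1, ..., s are represented by the ordinals 0, ..., s - 1. *)
Implicit Types (A : T) (Bs : 'I_s -> fps T).

(** e^{b_s h B_s} e^{a_s h A} ... e^{b_1 h B_1} e^{a_1 h A}; [rev_ord] puts the
    last stage leftmost. *)
Definition splitting_step A Bs (a b : 'I_s -> R) : fps T :=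
  \prod_(j < s)
    (fps_exp (b (rev_ord j) *: (fpsh * Bs (rev_ord j))) *
     fps_exp (a (rev_ord j) *: (fpsh * fpsC A))).

Definition in_Lambda k (lam : k.-tuple 'I_s) : bool :=
  sorted (fun i j : 'I_s => i <= j)%N lam.

Definition decorated_pair : choiceType :=
  {k : nat & (k.-tuple nat * k.-tuple 'I_s)%type}.

Definition decorated_multi_index : set decorated_pair :=
  [set d | in_Lambda (tagged d).2].

Definition mi_fact k (mu : k.-tuple nat) : nat :=
  (\prod_(i < k) (tnth mu i)`!)%N.

Definition mi_size k (mu : k.-tuple nat) : nat :=
  (k + \sum_(i < k) tnth mu i)%N.

Definition FF A Bs k (mu : k.-tuple nat) (lam : k.-tuple 'I_s) : fps T :=
  fpsh ^+ mi_size mu *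
  \prod_(i < k)
    ad (- fpsC A) (tnth mu (rev_ord i)) (Bs (tnth lam (rev_ord i))).

(** q_1! ... q_s! *)
Definition sym_factor k (lam : k.-tuple 'I_s) : nat :=
  (\prod_(i < s) (count_mem i lam)`!)%N.

Definition series_term A Bs (alpha : forall k, k.-tuple nat -> k.-tuple 'I_s -> R)
    (d : decorated_pair) : fps T :=
  let: existT k (mu, lam) := d in
  ((sym_factor lam)%:R^-1 * (alpha k mu lam / (mi_fact mu)%:R)) *:
  FF A Bs mu lam.

Definition B_Lambda A Bs (alpha : forall k, k.-tuple nat -> k.-tuple 'I_s -> R) :
  fps T := fps_sum decorated_multi_index (series_term A Bs alpha).

Definition cnode (a : 'I_s -> R) (m : 'I_s) : R := \sum_(j < s | (j <= m)%N) a j.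

Definition splitting_coef (a b : 'I_s -> R) k (mu : k.-tuple nat)
    (lam : k.-tuple 'I_s) : R :=
  \prod_(i < k) (b (tnth lam i) * cnode a (tnth lam i) ^+ tnth mu i).

End Decorated.

(* Main.v *)
(** Let [e x = exp (x h A)] and [C_j = a_1 + ... + a_j].  Since
    [exp (b_j h B_j) e (C_j) = e (C_j) exp (Z_j)] with
    [Z_j = e (- C_j) (b_j h B_j) e (C_j)], all the exponentials of [A] can be
    moved to the left, which gives [e 1 * exp Z_s * ... * exp Z_1].  Expanding
    each exponential, the monomials [Z_s^{q_s} ... Z_1^{q_1} / (q_1! ... q_s!)]
    correspond to the nondecreasing words [lambda], with their symmetry factors;
    Hadamard's formula [Z_j = sum_m b_j C_j^m h^{m+1} / m! ad_{-A}^m (B_j)] then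
    brings in [mu].  Infinite sums are compared modulo [h^p] for every [p], which
    makes all the sums finite. *)
Require Import Defs.
From HB Require Import structures.
From mathcomp Require Import all_boot all_order all_algebra.
From mathcomp Require Import boolp classical_sets functions cardinality fsbigop reals.

Set Implicit Arguments.
Unset Strict Implicit.
Unset Printing Implicit Defensive.

Import GRing.Theory.
Local Open Scope ring_scope.

(** * Reindexing of double sums and binomial expansion of iterated commutators *)

Lemma triangular_sum (V : nmodType) N (G : nat -> nat -> V) :
  \sum_(i < N) \sum_(j < N | (i + j < N)%N) G i j =
  \sum_(m < N) \sum_(i < m.+1) G i (m - i)%N.
Proof.
(* [F] extends the summand by zero to the square [m, i < N], where the two sums can be exchanged;
   for fixed [i], the shift [m = i + j] then gives back the triangle. *)
pose F m i := if (i <= m)%N then G i (m - i)%N else 0.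
transitivity (\sum_(m < N) \sum_(i < N) F m i); last first.
  apply: eq_bigr => m _.
  rewrite (big_ord_widen N (fun i => G i (m - i)%N) (ltn_ord m)) [RHS]big_mkcond.
  by apply: eq_bigr => i _; rewrite ltnS.
rewrite exchange_big; apply: eq_bigr => i _ /=.
rewrite -(big_mkord xpredT (F^~ i)) (big_cat_nat (leq0n i) (ltnW (ltn_ord i))) /=.
rewrite [X in _ = X + _]big_nat_cond [X in _ = X + _]big1 ?add0r; last first.
  by move=> m /andP[/andP[_ mi] _]; rewrite /F leqNgt mi.
rewrite -[X in \sum_(X <= _ < N) _]add0n big_addn big_mkord.
rewrite (big_ord_widen_cond N xpredT (fun j => F (j + i)%N i)) ?leq_subr //.
apply: eq_big => [j|j _]; first by rewrite /= ltn_subRL.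
by rewrite /F leq_addl addnK.
Qed.

(** Left multiplication by [Y] and right multiplication by [Z] commute as operators, so the binomial
    theorem applies to their sum; the induction step is Pascal's rule. *)
Lemma iter_mulDmul (S : nzRingType) (Y Z X : S) m :
  iter m (fun W => Y * W + W * Z) X =
  \sum_(i < m.+1) (Y ^+ i * X * Z ^+ (m - i)) *+ 'C(m, i).
Proof.
elim: m => [|m IHm]; first by rewrite big_ord1 mul1r mulr1.
rewrite iterS IHm mulr_sumr mulr_suml.
rewrite [in LHS]addrC [in RHS]big_ord_recl [in X in X + _]big_ord_recl /=.
rewrite !bin0 !mulr1n -addrA; congr (_ + _).
  by rewrite subn0 -!mulrA -exprSr.
transitivity (\sum_(i < m.+1) (Y ^+ i.+1 * X * Z ^+ (m - i)) *+ 'C(m, i.+1) +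
              \sum_(i < m.+1) (Y ^+ i.+1 * X * Z ^+ (m - i)) *+ 'C(m, i)).
  congr (_ + _).
    rewrite big_ord_recr /= bin_small // mulr0n addr0.
    apply: eq_bigr => i _; rewrite mulrnAl -!mulrA -exprSr /bump /= add1n.
    by rewrite subnSK.
  by apply: eq_bigr => i _; rewrite mulrnAr !mulrA -exprS.
rewrite -big_split /=; apply: eq_bigr => i _.
by rewrite -mulrnDr /bump /= add1n subSS binS.
Qed.

(** The bracket with [Y] is left multiplication by [Y] plus right multiplication by [- Y]. *)
Lemma ad_binomial (S : nzRingType) (Y X : S) m :
  ad Y m X = \sum_(i < m.+1) (Y ^+ i * X * (- Y) ^+ (m - i)) *+ 'C(m, i).
Proof.
rewrite -iter_mulDmul; apply: eq_iter => W.
by rewrite /commutator mulrN.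
Qed.

(** * Congruence of power series modulo [h^p] *)

Record eqh (T : nzRingType) p (f g : fps T) : Prop :=
  Eqh { eqh_coef : forall n, (n < p)%N -> f n = g n }.

Section Congruence.
Variable T : nzRingType.
Implicit Types (f g : fps T) (p q : nat).

Lemma coef_fps_mul f g n : (f * g) n = \sum_(i < n.+1) f i * g (n - i)%N.
Proof. by []. Qed.

Lemma coef_fps_sum I (r : seq I) (P : pred I) (F : I -> fps T) n :
  (\sum_(i <- r | P i) F i) n = \sum_(i <- r | P i) F i n.
Proof. by elim/big_rec2: _ => //= i y x _ <-. Qed.

Lemma eqh_eq f g : (forall p, eqh p f g) -> f = g.
Proof. by move=> fg; apply/fpsP => n; apply: (eqh_coef (fg n.+1)). Qed.

Lemma eqhxx p f : eqh p f f. Proof. by []. Qed.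

Lemma eqhS p f g : eqh p f g -> eqh p g f.
Proof. by move=> fg; split=> n np; rewrite (eqh_coef fg). Qed.

Lemma eqhT p f g k : eqh p f g -> eqh p g k -> eqh p f k.
Proof. by move=> fg gk; split=> n np; rewrite (eqh_coef fg) // (eqh_coef gk). Qed.

Lemma eqhW p q f g : (p <= q)%N -> eqh q f g -> eqh p f g.
Proof.
by move=> pq fg; split=> n np; apply: (eqh_coef fg); apply: leq_trans pq.
Qed.

Lemma eqh_sum p I (r : seq I) (P : pred I) (F G : I -> fps T) :
  (forall i, P i -> eqh p (F i) (G i)) ->
  eqh p (\sum_(i <- r | P i) F i) (\sum_(i <- r | P i) G i).
Proof.
move=> FG; split=> n np; rewrite !coef_fps_sum.
by apply: eq_bigr => i /FG/eqh_coef ->.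
Qed.

Lemma eqh_mul p f f' g g' : eqh p f f' -> eqh p g g' -> eqh p (f * g) (f' * g').
Proof.
move=> ff gg; split=> n np; rewrite !coef_fps_mul; apply: eq_bigr => i _.
congr (_ * _).
  by apply: (eqh_coef ff); apply: leq_ltn_trans np; rewrite -ltnS.
by apply: (eqh_coef gg); apply: leq_ltn_trans np; apply: leq_subr.
Qed.

Lemma eqh_prod p I (r : seq I) (P : pred I) (F G : I -> fps T) :
  (forall i, P i -> eqh p (F i) (G i)) ->
  eqh p (\prod_(i <- r | P i) F i) (\prod_(i <- r | P i) G i).
Proof. by move=> FG; elim/big_rec2: _ => // i y x /FG; apply: eqh_mul. Qed.

(** When [n < p + q], each product [f i * g (n - i)] has [i < p] or [n - i < q]. *)
Lemma eqh0_mul p q f g : eqh p f 0 -> eqh q g 0 -> eqh (p + q) (f * g) 0.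
Proof.
move=> f0 g0; split=> n npq; rewrite coef_fps_mul big1 // => i _.
have [ip|pi] := ltnP i p; first by rewrite (eqh_coef f0) ?mul0r.
rewrite (eqh_coef g0) ?mulr0 // -(ltn_add2l i) subnKC; last by rewrite -ltnS.
by apply: leq_trans npq _; rewrite leq_add2r.
Qed.

Lemma eqh0_exp f k : f 0%N = 0 -> eqh k (f ^+ k) 0.
Proof. by move=> f0; split=> n nk; rewrite fps_expr_lt. Qed.

(** On either side, multiplication by [h] shifts the coefficients by one: only index [1] survives in
    one convolution, and only the last index but one in the other. *)
Lemma fpsh_comm f : GRing.comm fpsh f.
Proof.
apply/fpsP => -[|n]; rewrite !coef_fps_mul.
  by rewrite !big_ord1 /= mul0r mulr0.
rewrite big_ord_recl /= mul0r add0r big_ord_recl /= mul1r subSS subn0.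
rewrite big1 ?addr0; last by move=> i _; rewrite mul0r.
rewrite big_ord_recr /= subnn mulr0 addr0 big_ord_recr /= subSnn mulr1.
rewrite big1 ?add0r // => i _.
have := ltn_ord i; rewrite -subn_gt0 => ni; rewrite subSn ?(ltnW (ltn_ord i)) //=.
by case: (n - i)%N ni => // ? _; rewrite mulr0.
Qed.

Lemma fpsh_mul_coef0 f : (fpsh * f) 0%N = 0.
Proof. by rewrite coef_fps_mul big_ord1 /= mul0r. Qed.

End Congruence.

Lemma eqh_scale (R : pzRingType) (T : algType R) p (f g : fps T) (c : R) :
  eqh p f g -> eqh p (c *: f) (c *: g).
Proof. by move=> fg; split=> n np; congr (_ *: _); apply: (eqh_coef fg). Qed.

(** * Formal exponentials *)

Section Exponential.
Variables (R : realType) (T : algType R).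
Implicit Types X Y Z : fps T.

Lemma fps_exp_trunc p X : X 0%N = 0 ->
  eqh p (fps_exp X) (\sum_(k < p) (k`!%:R : R)^-1 *: X ^+ k).
Proof.
move=> X0; split=> n np; rewrite coef_fps_sum (fsbig_ord _ _ (fun k => fps_exp_term X k n)).
apply/esym/fsbig_widen => // k [_ /= /negP]; rewrite -leqNgt => pk.
by rewrite fps_expr_lt ?scaler0 // (leq_trans np).
Qed.

Lemma fps_exp0 : fps_exp (0 : fps T) = 1.
Proof.
(* Working modulo [h^(p+1)] makes the truncated sum nonempty, so that its term [k = 0] can be split
   off. *)
apply: eqh_eq => p; apply: (eqhW (leqnSn p)).
apply: eqhT (fps_exp_trunc _ _) _ => //.
rewrite big_ord_recl big1 ?addr0 ?fact0 ?invr1 ?scale1r // => i _.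
by rewrite exprS mul0r scaler0.
Qed.

Lemma invf_fact_bin m i : (i <= m)%N ->
  (i`!%:R : R)^-1 * ((m - i)`!%:R)^-1 = (m`!%:R)^-1 * 'C(m, i)%:R.
Proof.
move=> im; rewrite -(bin_fact im) !natrM !invfM [RHS]mulrAC mulVf ?mul1r //.
by rewrite Num.Theory.pnatr_eq0 -lt0n bin_gt0.
Qed.

(* Both sides of the exponential identities below are double sums over [i, j < p]
   whose terms with [i + j >= p] vanish modulo [h^p]. *)
Lemma fps_exp_sandwich p X Y Z : Y 0%N = 0 -> Z 0%N = 0 ->
  eqh p (fps_exp Y * X * fps_exp Z)
    (\sum_(m < p) (m`!%:R : R)^-1 *:
       \sum_(i < m.+1) (Y ^+ i * X * Z ^+ (m - i)) *+ 'C(m, i)).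
Proof.
move=> Y0 Z0.
apply: eqhT (eqh_mul (eqh_mul (fps_exp_trunc _ Y0) (eqhxx _ _)) (fps_exp_trunc _ Z0)) _.
pose G i j : fps T := ((i`!%:R : R)^-1 * (j`!%:R)^-1) *: (Y ^+ i * X * Z ^+ j).
have -> : \sum_(m < p) (m`!%:R : R)^-1 *:
      (\sum_(i < m.+1) (Y ^+ i * X * Z ^+ (m - i)) *+ 'C(m, i)) =
    \sum_(m < p) \sum_(i < m.+1) G i (m - i)%N.
  apply: eq_bigr => m _; rewrite scaler_sumr; apply: eq_bigr => i _.
  rewrite /G (invf_fact_bin (ltn_ord i : (i <= m)%N)) -scalerA scaler_nat.
  by [].
rewrite -triangular_sum !mulr_suml; apply: eqh_sum => i _.
rewrite mulr_sumr [X in eqh _ _ X]big_mkcond; apply: eqh_sum => j _.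
have -> : (i`!%:R : R)^-1 *: Y ^+ i * X * ((j`!%:R : R)^-1 *: Z ^+ j) = G i j.
  by rewrite -!scalerAl -!scalerAr scalerA.
case: ltnP => // pij; apply: eqhW pij _.
suff : eqh (i + j) (Y ^+ i * X * Z ^+ j) 0.
  by move=> /(eqh_scale ((i`!%:R : R)^-1 * (j`!%:R)^-1)); rewrite scaler0.
apply: eqh0_mul _ (eqh0_exp _ Z0).
(* The middle factor [X] is arbitrary, hence counted with order [0]. *)
suff: eqh (i + 0) (Y ^+ i * X) 0 by rewrite addn0.
by apply: eqh0_mul (eqh0_exp _ Y0) _; split.
Qed.

(** This is [fps_exp_sandwich] around the middle factor [1]: its inner sums are the binomial
    expansions of the powers of [X + Y]. *)
Lemma fps_exp_add X Y : X 0%N = 0 -> Y 0%N = 0 -> GRing.comm X Y ->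
  fps_exp (X + Y) = fps_exp X * fps_exp Y.
Proof.
move=> X0 Y0 cXY; apply: eqh_eq => p.
apply: eqhT (fps_exp_trunc _ _) _; first by rewrite /= X0 Y0 addr0.
rewrite -[fps_exp X]mulr1; apply: eqhS; apply: eqhT (fps_exp_sandwich _ _ X0 Y0) _.
apply: eqh_sum => m _; rewrite addrC exprDn_comm; last exact: commr_sym.
apply: eqh_scale; apply: eqh_sum => i _; rewrite mulr1.
by rewrite (commrX _ (commr_sym (commrX _ (commr_sym cXY)))).
Qed.

(** This is [fps_exp_sandwich] with [Z = - Y], whose inner sums are the iterated commutators of
    [ad_binomial]. *)
Lemma fps_exp_hadamard p X Y : Y 0%N = 0 ->
  eqh p (fps_exp Y * X * fps_exp (- Y)) (\sum_(m < p) (m`!%:R : R)^-1 *: ad Y m X).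
Proof.
move=> Y0; apply: eqhT (fps_exp_sandwich _ _ Y0 _) _; first by rewrite /= Y0 oppr0.
by apply: eqh_sum => m _; rewrite ad_binomial.
Qed.

(** Conjugation by an invertible element is linear and multiplicative, so it passes through every
    truncation of the exponential. *)
Lemma fps_exp_conj (U V X : fps T) : U * V = 1 -> V * U = 1 -> X 0%N = 0 ->
  V * fps_exp X * U = fps_exp (V * X * U).
Proof.
move=> UV VU X0; apply: eqh_eq => p.
apply: eqhT (eqh_mul (eqh_mul (eqhxx _ _) (fps_exp_trunc _ X0)) (eqhxx _ _)) _.
have VXU0 : (V * X * U) 0%N = 0.
  by rewrite coef_fps_mul big_ord1 coef_fps_mul big_ord1 X0 mulr0 mul0r.
apply: eqhS; apply: eqhT (fps_exp_trunc _ VXU0) _.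
rewrite mulr_sumr mulr_suml; apply: eqh_sum => k _.
rewrite -scalerAr -scalerAl; apply: eqh_scale.
suff -> : (V * X * U) ^+ k = V * X ^+ k * U by [].
elim: (k : nat) => [|m IHm]; first by rewrite mulr1.
by rewrite !exprS IHm -!mulrA (mulrA U V) UV mul1r.
Qed.

End Exponential.

(** * Reversed products and nondecreasing words *)

Lemma rev_enum_ord n : rev (enum 'I_n) = map (@rev_ord n) (enum 'I_n).
Proof.
apply: (inj_map val_inj); rewrite map_rev val_enum_ord -map_comp.
apply: (@eq_from_nth _ 0%N) => [|i].
  by rewrite size_rev size_iota size_map size_enum_ord.
rewrite size_rev size_iota => ltin; rewrite nth_rev size_iota // nth_iota; last first.
  by rewrite subnSK // leq_subr.
by rewrite (nth_map (Ordinal ltin)) ?size_enum_ord //= nth_enum_ord.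
Qed.

Lemma prod_rev_enum (S : nzRingType) n (F : 'I_n -> S) :
  \prod_(i <- rev (enum 'I_n)) F i = \prod_(i < n) F (rev_ord i).
Proof. by rewrite rev_enum_ord big_map enumT [index_enum _]unlock. Qed.

Lemma prod_rev_tuple (S : nzRingType) I k (t : k.-tuple I) (F : I -> S) :
  \prod_(x <- rev t) F x = \prod_(i < k) F (tnth t (rev_ord i)).
Proof. by rewrite -[in LHS](map_tnth_enum t) -map_rev big_map prod_rev_enum. Qed.

Section Words.
Variable s : nat.
Implicit Types (q : 'I_s -> nat) (w : seq 'I_s).

(** The nondecreasing word with letter multiplicities [q]; with [count_word] and [word_count], it
    puts multiplicity vectors and nondecreasing words in bijection. *)
Definition word q : seq 'I_s := flatten [seq nseq (q i) i | i <- enum 'I_s].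

Lemma count_word q i : count_mem i (word q) = q i.
Proof.
rewrite /word count_flatten -map_comp sumnE big_map big_enum /=.
rewrite (bigD1 i) //= count_nseq /= eqxx mul1n big1 ?addn0 // => j /negPf ji.
by rewrite count_nseq /= ji.
Qed.

Lemma size_word q : size (word q) = (\sum_i q i)%N.
Proof.
rewrite /word size_flatten /shape -map_comp sumnE big_map big_enum /=.
by apply: eq_bigr => i _; rewrite size_nseq.
Qed.

Lemma sorted_word q : sorted (fun i j : 'I_s => i <= j)%N (word q).
Proof.
have : sorted (fun i j : 'I_s => i <= j)%N (enum 'I_s).
  by have := iota_sorted 0 s; rewrite -val_enum_ord sorted_map.
have tr : transitive (fun i j : 'I_s => i <= j)%N by move=> ? ? ?; apply: leq_trans.
(* In pairwise form, sortedness of a concatenation splits into a condition inside each block of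
   equal letters and one across blocks. *)
rewrite !(sorted_pairwise tr) /word; elim: (enum _) => //= i r IHr /andP[ir /IHr qr].
rewrite pairwise_cat qr andbT; apply/andP; split; last first.
  by elim: (q i) => //= m ->; rewrite andbT all_nseq leqnn orbT.
apply/allrelP => x y /nseqP[-> _] /flattenP[_ /mapP[j jr ->]] /nseqP[-> _].
exact: (allP ir).
Qed.

Lemma word_count w : sorted (fun i j : 'I_s => i <= j)%N w ->
  word (fun i => count_mem i w) = w.
Proof.
move=> sw; apply: (sorted_eq _ _ (sorted_word _) sw).
- by move=> ? ? ?; apply: leq_trans.
- by move=> i j /anti_leq/val_inj.
- by apply/allP => i _; rewrite /= count_word.
Qed.

(** Equal letters are adjacent in [word q], so they group into powers; the reversal puts the largest
    letter leftmost. *)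
Lemma prod_rev_word (S : nzRingType) (X : 'I_s -> S) q :
  \prod_(i <- rev (word q)) X i =
  \prod_(j < s) X (rev_ord j) ^+ q (rev_ord j).
Proof.
rewrite /word rev_flatten big_flatten -!map_rev !big_map -enumT prod_rev_enum.
apply: eq_bigr => i _; rewrite rev_nseq big_nseq.
by elim: (q _) => // m IHm; rewrite iterS IHm exprS.
Qed.

End Words.

(** * Products of exponentials: expansion over words and telescoping *)

Section ProductOfExponentials.
Variables (R : realType) (T : algType R).

Lemma eqh0_prod n (e : 'I_n -> nat) (F : 'I_n -> fps T) :
  (forall i, eqh (e i) (F i) 0) -> eqh (\sum_i e i) (\prod_i F i) 0.
Proof.
by move=> F0; elim/big_rec2: _ => [|i x m _]; [split | apply: eqh0_mul].
Qed.

(** Distributing the truncated exponentials gives a sum over exponent vectors [q]. Those of total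
    degree at least [p] vanish modulo [h^p]; those of total degree [k] correspond through [word] to
    the nondecreasing words of length [k]. *)
Lemma prod_fps_exp_words p s (X : 'I_s -> fps T) : (forall j, X j 0%N = 0) ->
  eqh p (\prod_(j < s) fps_exp (X (rev_ord j)))
    (\sum_(k < p) \sum_(lam : k.-tuple 'I_s | in_Lambda lam)
       ((sym_factor lam)%:R : R)^-1 *: \prod_(i < k) X (tnth lam (rev_ord i))).
Proof.
move=> X0; case: p => [|p]; first by split.
apply: eqhT (eqh_prod _ (fun j _ => fps_exp_trunc p.+1 (X0 (rev_ord j)))) _.
rewrite bigA_distr_bigA /=.
pose wd (q : {ffun 'I_s -> 'I_p.+1}) := word (fun i => q i).
pose G (q : {ffun 'I_s -> 'I_p.+1}) : fps T :=
  ((\prod_(i < s) (q i)`!)%N%:R : R)^-1 *: \prod_(i <- rev (wd q)) X i.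
(* Distribution indexes exponents by the position of a factor in the product, while [G] indexes them
   by its letter; [rv] passes from one to the other. *)
pose rv (q : {ffun 'I_s -> 'I_p.+1}) : {ffun 'I_s -> 'I_p.+1} :=
  [ffun j => q (rev_ord j)].
have rvK : involutive rv by move=> q; apply/ffunP => j; rewrite !ffunE rev_ordK.
rewrite (reindex_inj (inv_inj rvK)) /=.
have -> : \sum_q \prod_j (((rv q j)`!%:R : R)^-1 *: X (rev_ord j) ^+ rv q j) =
          \sum_q G q.
  apply: eq_bigr => q _; rewrite scaler_prod /G /wd prod_rev_word; congr (_ *: _).
    rewrite (reindex_inj rev_ord_inj) natr_prod prodfV; congr (_^-1).
    by apply: eq_bigr => j _; rewrite ffunE rev_ordK.
  by apply: eq_bigr => j _; rewrite ffunE.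
pose tot (q : {ffun 'I_s -> 'I_p.+1}) := (\sum_j q j)%N.
apply: eqhT (_ : eqh p.+1 _ (\sum_(q | (tot q < p.+1)%N) G q)) _.
  rewrite [X in eqh _ _ X]big_mkcond; apply: eqh_sum => q _.
  case: ltnP => // ptot; apply: eqhW ptot _.
  rewrite /G -[X in eqh _ _ X](scaler0 _ ((\prod_(i < s) (q i)`!)%N%:R^-1 : R)).
  apply: eqh_scale; rewrite /wd prod_rev_word /tot (reindex_inj rev_ord_inj).
  by apply: eqh0_prod => j; apply: eqh0_exp.
rewrite (partition_big (fun q => inord (tot q) : 'I_p.+1) xpredT) //=.
suff -> : \sum_(k < p.+1) \sum_(q | (tot q < p.+1)%N && (inord (tot q) == k)) G q =
  \sum_(k < p.+1) \sum_(lam : k.-tuple 'I_s | in_Lambda lam)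
       ((sym_factor lam)%:R : R)^-1 *: \prod_(i < k) X (tnth lam (rev_ord i)) by [].
apply: eq_bigr => k _.
(* A letter occurs at most [k < p.+1] times, so [inord] leaves its count unchanged. *)
pose cnt (lam : k.-tuple 'I_s) : {ffun 'I_s -> 'I_p.+1} :=
  [ffun i => inord (count_mem i lam)].
have cntE lam i : cnt lam i = count_mem i lam :> nat.
  rewrite ffunE inordK //; apply: leq_ltn_trans (ltn_ord k).
  by rewrite -[leqRHS](size_tuple lam) count_size.
have totE q : ((tot q < p.+1)%N && (inord (tot q) == k)) = (tot q == k).
  apply/andP/eqP => [[tp /eqP <-]|tk]; first by rewrite inordK.
  by rewrite tk ltn_ord inord_val.
have word_cnt lam : in_Lambda lam -> wd (cnt lam) = lam.
  move=> slam; rewrite -[RHS](word_count slam) /wd /word.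
  by congr flatten; apply: eq_map => i; rewrite cntE.
rewrite (eq_bigl _ _ totE).
(* The inverse of [cnt] is partial: [insub] turns the list [wd q] into a [k]-tuple when its length
   is [k]. The side condition left by the reindexing amounts to [lam] being nondecreasing. *)
rewrite (reindex_omap cnt (fun q => insub (wd q) : option (k.-tuple 'I_s))) /=; last first.
  move=> q tq; have sz : size (wd q) == k by rewrite size_word.
  rewrite (insubT (fun w => size w == k) sz) /=.
  by congr Some; apply/ffunP => i; apply: val_inj; rewrite [LHS]cntE count_word.
apply: eq_big => [lam|lam /andP[_ /eqP wlam]].
  apply/andP/idP => [[_ /eqP wlam]|slam].
    have : in_Lambda lam = sorted (fun i j : 'I_s => i <= j)%N (wd (cnt lam)).
      by move: wlam; case: insubP => // u _ <- [->].
    by rewrite sorted_word.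
  split; first by rewrite /tot -size_word -/(wd _) word_cnt // size_tuple.
  by rewrite word_cnt // valK.
rewrite /G (_ : wd (cnt lam) = lam :> seq _); last first.
  by move: wlam; case: insubP => // u _ <- [->].
rewrite prod_rev_tuple; congr (_%:R^-1 *: _).
by apply: eq_bigr => i _; rewrite cntE.
Qed.

End ProductOfExponentials.

(* With [C_j] the partial sums of [a] and [C_s] the full sum, each factor is
   rewritten as [X_j e(a_j) e(C_(j-1)) = e(C_j) (e(- C_j) X_j e(C_j))], so that
   the [e]'s accumulate on the left. *)
Lemma prod_conj_telescope (R : realType) (S : nzRingType) (e : R -> S) s
    (a : 'I_s -> R) (X : 'I_s -> S) :
  e 0 = 1 -> {morph e : x y / x + y >-> x * y} ->
  \prod_(j < s) (X (rev_ord j) * e (a (rev_ord j))) =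
  e (\sum_j a j) * \prod_(j < s) (e (- cnode a (rev_ord j)) * X (rev_ord j) *
                                  e (cnode a (rev_ord j))).
Proof.
move=> e0 eD; elim: s a X => [|s IHs] a X; first by rewrite !big_ord0 e0 mulr1.
have rev0 : rev_ord (@ord0 s) = ord_max by apply: val_inj; rewrite /= subn1.
have revS (j : 'I_s) : rev_ord (lift ord0 j) = widen_ord (leqnSn s) (rev_ord j).
  exact: val_inj.
have cmax : cnode a ord_max = \sum_j a j.
  by apply: eq_bigl => j; rewrite -ltnS ltn_ord.
(* Nodes before the last stage do not involve its coefficient, so the induction hypothesis for the
   first [s] stages yields the same nodes. *)
have cwiden j : cnode a (widen_ord (leqnSn s) j) =
    cnode (a \o widen_ord (leqnSn s)) j.
  rewrite /cnode big_mkcond big_ord_recr /= leqNgt ltn_ord addr0.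
  by rewrite [RHS]big_mkcond.
rewrite -cmax !big_ord_recl !rev0.
under eq_bigr do rewrite revS.
under [in RHS]eq_bigr do rewrite revS cwiden.
rewrite (IHs (a \o widen_ord _) (X \o widen_ord _)) !mulrA; congr (_ * _).
rewrite -!mulrA -eD !mulrA -eD subrr e0 mul1r; congr (_ * e _).
by rewrite cmax big_ord_recr addrC.
Qed.

(** * Hadamard expansion of a single stage *)

Section StageExpansion.
Variables (R : realType) (T : algType R) (A : T).
Local Notation H := (fpsh * fpsC A).

(** Scalars and [h] are central: each bracket contributes a factor [c h] and leaves a bracket with
    [- A], on top of the initial [b h]. *)
Lemma ad_scaled_h (b c : R) (B : fps T) m :
  ad (- c *: H) m (b *: (fpsh * B)) =
  (b * c ^+ m) *: (fpsh ^+ m.+1 * ad (- fpsC A) m B).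
Proof.
elim: m => [|m IHm]; first by rewrite mulr1 expr1.
rewrite /ad iterS [iter _ _ _]IHm [in RHS]iterS -/(ad _ _ _).
set W := ad _ m B; have hC k (X : fps T) : fpsh ^+ k * X = X * fpsh ^+ k.
  by apply: commr_sym; apply: commrX; apply: commr_sym; apply: fpsh_comm.
have eAW : H * (fpsh ^+ m.+1 * W) = fpsh ^+ m.+2 * (fpsC A * W).
  by rewrite [in RHS]exprS -!mulrA (mulrA (fpsC A)) -(hC _ (fpsC A)) !mulrA.
have eWA : fpsh ^+ m.+1 * W * H = fpsh ^+ m.+2 * (W * fpsC A).
  by rewrite [in RHS]exprSr -!mulrA (mulrA W) -(fpsh_comm W) !mulrA.
rewrite /commutator -!scalerAl -!scalerAr eAW eWA !scalerA (mulrC _ (- c)).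
rewrite -scalerBr -mulrBr mulNr scaleNr -scalerN -mulrN mulNr [W * (- _)]mulrN opprB opprK.
by rewrite mulrCA -exprS addrC.
Qed.

Lemma conj_stage p (b c : R) (B : fps T) :
  eqh p (fps_exp (- c *: H) * (b *: (fpsh * B)) * fps_exp (c *: H))
    (\sum_(m < p) (b * c ^+ m / m`!%:R) *: (fpsh ^+ m.+1 * ad (- fpsC A) m B)).
Proof.
have H0 x : (x *: H) 0%N = 0 by rewrite -[LHS]/(x *: H 0%N) fpsh_mul_coef0 scaler0.
have -> : c *: H = - (- c *: H) by rewrite scaleNr opprK.
apply: eqhT (fps_exp_hadamard _ _ (H0 _)) _.
by apply: eqh_sum => m _; rewrite ad_scaled_h scalerA mulrC.
Qed.

Lemma prod_fpsh_pow k (e : 'I_k -> nat) (F : 'I_k -> fps T) :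
  \prod_i (fpsh ^+ e i * F i) = fpsh ^+ (\sum_i e i) * \prod_i F i.
Proof.
elim/big_rec3: _ => [|i x n y _ ->]; first by rewrite mulr1.
rewrite exprD -!mulrA; congr (_ * _); rewrite !mulrA; congr (_ * _).
by apply: commrX; apply: commr_sym; apply: fpsh_comm.
Qed.

End StageExpansion.

(** * Truncation to finitely many multi-indices *)

Section FiniteMultiIndices.
Variables (p s : nat).

(** A finite type, hence enumerable, that covers all decorated pairs of size below [p]; larger sizes
    also occur in it. *)
Definition bounded_index := {k : 'I_p & ({ffun 'I_k -> 'I_p} * k.-tuple 'I_s)%type}.

Definition ffun_tuple k (f : {ffun 'I_k -> 'I_p}) : k.-tuple nat :=
  [tuple f i : nat | i < k].

Definition unbound_index (x : bounded_index) : decorated_pair s :=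
  existT _ (tag x : nat) (ffun_tuple (tagged x).1, (tagged x).2).

Lemma unbound_index_inj : injective unbound_index.
Proof.
case=> k [f l] [k' [f' l']] E.
have kk : k = k' by apply: val_inj; apply: (congr1 tag E).
case: _ / kk f' l' E => f' l' /eqP; rewrite eq_Tagged /= => /eqP[ff ->].
suff -> : f = f' by [].
apply/ffunP => i; apply: val_inj.
by have := congr1 (fun t => nth 0%N t i) ff; rewrite !nth_mktuple.
Qed.

(** The size of a multi-index bounds both its length and each of its entries. *)
Lemma unbound_index_surj k (mu : k.-tuple nat) (lam : k.-tuple 'I_s) :
  (mi_size mu < p)%N ->
  exists x, unbound_index x = existT _ k (mu, lam).
Proof.
move=> mup; have kp : (k < p)%N by apply: leq_ltn_trans mup; apply: leq_addr.
have mp i : (tnth mu i < p)%N.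
  apply: leq_ltn_trans mup; rewrite /mi_size (bigD1 i) //= addnCA.
  exact: leq_addr.
exists (existT _ (Ordinal kp) ([ffun i => Ordinal (mp i)], lam)).
rewrite /unbound_index /=; set t := ffun_tuple _.
suff -> : t = mu by [].
by apply: eq_from_tnth => i; rewrite tnth_mktuple ffunE.
Qed.

Lemma fsbig_bounded (V : nmodType) (F : decorated_pair s -> V) :
  (forall k (mu : k.-tuple nat) lam, (p <= mi_size mu)%N ->
     F (existT _ k (mu, lam)) = 0) ->
  \sum_(d \in @decorated_multi_index s) F d =
  \sum_(k < p) \sum_(lam : k.-tuple 'I_s | in_Lambda lam)
     \sum_(f : {ffun 'I_k -> 'I_p}) F (existT _ (k : nat) (ffun_tuple f, lam)).
Proof.
move=> F0.
rewrite (fsbigE [seq unbound_index x | x <- enum {: bounded_index}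
                                     & in_Lambda (tagged x).2]).
- rewrite big_map big_filter_cond big_enum_cond /=.
  transitivity (\sum_(x : bounded_index | in_Lambda (tagged x).2) F (unbound_index x)).
    apply: eq_bigl => x; rewrite -[RHS]andbb; congr (_ && _).
    by apply/idP/idP => [/set_mem|?]; last exact: mem_set.
  transitivity (\sum_(k < p) \sum_(y : {ffun 'I_k -> 'I_p} * k.-tuple 'I_s
      | in_Lambda y.2) F (existT _ (k : nat) (ffun_tuple y.1, y.2))).
    by rewrite sig_big_dep.
  apply: eq_bigr => k _; rewrite exchange_big pair_big /=.
  by apply: eq_bigr => -[].
- by rewrite (map_inj_uniq unbound_index_inj) filter_uniq // enum_uniq.
- by move=> _ /= /mapP[x + ->]; rewrite mem_filter => /andP[].
- case=> k [mu lam] slam /negP nr; apply: F0; rewrite leqNgt; apply/negP.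
  move=> /(unbound_index_surj lam)[x xE]; apply: nr; rewrite -xE map_f //.
  by rewrite mem_filter mem_enum andbT; move: slam; rewrite -xE.
Qed.

Lemma finite_bounded (D : set (decorated_pair s)) :
  (forall k (mu : k.-tuple nat) (lam : k.-tuple 'I_s),
     D (existT _ k (mu, lam)) -> (mi_size mu < p)%N) ->
  finite_set D.
Proof.
move=> DP; apply: (@sub_finite_set _ _ (unbound_index @` [set: bounded_index])%classic).
  by move=> [k [mu lam]] /DP/(unbound_index_surj lam)[x <-]; exists x.
exact/finite_image/finite_finset.
Qed.

End FiniteMultiIndices.

(** * Expansion of the splitting step *)

Section SplittingExpansion.
Variables (R : realType) (T : algType R) (A : T) (s : nat).
Variables (a b : 'I_s -> R) (Bs : 'I_s -> fps T).
Local Notation H := (fpsh * fpsC A).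
Local Notation term := (series_term A Bs (splitting_coef a b)).

Lemma series_term_eq0 p k (mu : k.-tuple nat) (lam : k.-tuple 'I_s) :
  (p <= mi_size mu)%N -> eqh p (term (existT _ k (mu, lam))) 0.
Proof.
move=> pmu; apply: eqhW pmu _; rewrite /series_term /FF.
rewrite -[X in eqh _ _ X](scaler0 _ (((sym_factor lam)%:R : R)^-1 *
  (splitting_coef a b mu lam / (mi_fact mu)%:R))).
apply: eqh_scale; rewrite -[mi_size _ in X in eqh X]addn0.
by apply: eqh0_mul (eqh0_exp _ _) _; last split.
Qed.

(** The prefactor [h^|mu|] kills the coefficient of [h^n] as soon as [|mu| > n]. *)
Lemma series_term_summable : fps_summable (@decorated_multi_index s) term.
Proof.
move=> n; apply: (@finite_bounded n.+1) => k mu lam [_ /= tn].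
rewrite ltnNge; apply/negP => /(series_term_eq0 lam)/eqh_coef/(_ n (ltnSn n)).
exact: tn.
Qed.

Lemma coef_B_Lambda p : eqh p (B_Lambda A Bs (splitting_coef a b))
  (\sum_(k < p) \sum_(lam : k.-tuple 'I_s | in_Lambda lam)
     \sum_(f : {ffun 'I_k -> 'I_p}) term (existT _ (k : nat) (ffun_tuple f, lam))).
Proof.
split=> n np; rewrite /= (@fsbig_bounded p); last first.
  by move=> k mu lam /(series_term_eq0 lam)/eqh_coef ->.
rewrite coef_fps_sum; apply: eq_bigr => k _.
rewrite coef_fps_sum; apply: eq_bigr => lam _.
by rewrite coef_fps_sum.
Qed.

(** Distributing the product of Hadamard sums selects one bracket order per letter, and these orders
    form [mu]; all scalars and powers of [h] are then collected in front. *)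
Lemma stage_word p k (lam : k.-tuple 'I_s) (Z : 'I_s -> fps T) :
  (forall j, Z j = fps_exp (- cnode a j *: H) * (b j *: (fpsh * Bs j)) *
                   fps_exp (cnode a j *: H)) ->
  eqh p (((sym_factor lam)%:R : R)^-1 *: \prod_(i < k) Z (tnth lam (rev_ord i)))
    (\sum_(f : {ffun 'I_k -> 'I_p}) term (existT _ k (ffun_tuple f, lam))).
Proof.
move=> ZE.
have Zz j : eqh p (Z j) (\sum_(m < p) (b j * cnode a j ^+ m / m`!%:R) *:
    (fpsh ^+ m.+1 * ad (- fpsC A) m (Bs j))) by rewrite ZE; apply: conj_stage.
apply: eqhT (eqh_scale _ (eqh_prod _ (fun i _ => Zz _))) _.
rewrite bigA_distr_bigA scaler_sumr /=.
pose rv (f : {ffun 'I_k -> 'I_p}) : {ffun 'I_k -> 'I_p} :=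
  [ffun j => f (rev_ord j)].
have rvK : involutive rv by move=> q; apply/ffunP => j; rewrite !ffunE rev_ordK.
rewrite (reindex_inj (inv_inj rvK)) /=.
apply: eqh_sum => f _; rewrite scaler_prod scalerA prod_fpsh_pow /series_term /FF.
have -> : \prod_i (b (tnth lam (rev_ord i)) * cnode a (tnth lam (rev_ord i)) ^+ rv f i
            / (rv f i)`!%:R) =
          splitting_coef a b (ffun_tuple f) lam / (mi_fact (ffun_tuple f))%:R.
  rewrite (reindex_inj rev_ord_inj) /= /splitting_coef /mi_fact natr_prod -prodf_div.
  by apply: eq_bigr => i _; rewrite ffunE !rev_ordK tnth_mktuple.
(* A letter with bracket order [m] carries [h^(m+1)]; the extra units add up to the length [k] in
   [mi_size]. *)
have -> : (\sum_i (rv f i).+1 = mi_size (ffun_tuple f))%N.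
  rewrite (reindex_inj rev_ord_inj) /mi_size /= -[X in (X + _)%N]card_ord -sum1_card.
  rewrite -big_split /=; apply: eq_bigr => i _.
  by rewrite ffunE rev_ordK tnth_mktuple.
rewrite (eq_bigr (fun i => ad (- fpsC A) (tnth (ffun_tuple f) (rev_ord i))
                              (Bs (tnth lam (rev_ord i))))) //.
by move=> i _; rewrite ffunE tnth_mktuple.
Qed.

Lemma splitting_step_expansion : \sum_j a j = 1 ->
  splitting_step A Bs a b =
  fps_exp H * B_Lambda A Bs (splitting_coef a b).
Proof.
move=> a1; have H0 x : (x *: H) 0%N = 0.
  by rewrite -[LHS]/(x *: H 0%N) fpsh_mul_coef0 scaler0.
pose e x := fps_exp (x *: H).
have e0 : e 0 = 1 by rewrite /e scale0r fps_exp0.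
have eD : {morph e : x y / x + y >-> x * y}.
  move=> x y; rewrite /e scalerDl fps_exp_add //.
  by rewrite /GRing.comm -!scalerAl -!scalerAr !scalerA mulrC.
pose X j := b j *: (fpsh * Bs j).
have X0 j : X j 0%N = 0 by rewrite -[LHS]/(b j *: _ 0%N) fpsh_mul_coef0 scaler0.
pose Z j := e (- cnode a j) * X j * e (cnode a j).
have Z0 j : Z j 0%N = 0.
  by rewrite coef_fps_mul big_ord1 coef_fps_mul big_ord1 X0 mulr0 mul0r.
rewrite /splitting_step (prod_conj_telescope a (fun j => fps_exp (X j)) e0 eD).
rewrite a1 /e scale1r; congr (_ * _).
(* [e c] and [e (- c)] are mutually inverse, so the conjugation of each stage moves inside its
   exponential. *)
under eq_bigr => j _.
  rewrite (fps_exp_conj _ _ (X0 _)); first last.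
  - by rewrite -/(e _) -/(e _) -eD addNr e0.
  - by rewrite -/(e _) -/(e _) -eD subrr e0.
  over.
apply: eqh_eq => p; apply: eqhT (prod_fps_exp_words p Z0) _.
apply: eqhS; apply: eqhT (coef_B_Lambda p) _; apply: eqhS.
by apply: eqh_sum => k _; apply: eqh_sum => lam _; apply: stage_word.
Qed.

End SplittingExpansion.

Theorem proposition2p5 (R : realType) (T : algType R) (A B : T)
    (s : nat) (hs : (1 <= s)%N) (a b : 'I_s -> R) (ha : \sum_(j < s) a j = 1)
    (Bs : 'I_s -> fps T) (hB : forall j, modified_operator A B (Bs j)) :
  [/\ fps_summable (@decorated_multi_index s)
        (series_term A Bs (splitting_coef a b)),
      splitting_step A Bs a b =
        fps_exp (fpsh * fpsC A) * B_Lambda A Bs (splitting_coef a b)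
    & forall (V : lmodType (fps T)) (u : nat -> V),
        (forall n, u n.+1 = splitting_step A Bs a b *: u n) ->
        forall n, u n.+1 =
          (fps_exp (fpsh * fpsC A) * B_Lambda A Bs (splitting_coef a b)) *: u n].
Proof.
have E := splitting_step_expansion A b Bs ha.
by split=> [||V u uS n]; [apply: series_term_summable | | rewrite uS E].
Qed.
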